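(* Let $K$ be an oriented (multi-)knotoid diagram in $S^2$ which is a knot or a multi-knot (a link with a base point), i.e. whose leg and head lie on the same region of $S^2\setminus K$, and let $\widehat K$ be the oriented knot or link obtained by joining the head of $K$ to the leg by an embedded arc with interior disjoint from $K$, with base point $p$ on this arc. Then the three-variable Poincaré polynomial $W_K(t,q,u)$ of the winding homology $H(K)=\bigoplus_{i,j,k} H_{i,j}^k(K)$ agrees with the Poincaré polynomial of the reduced Khovanov homology (over $\mathbb{Q}$) of $(\widehat K,p)$: $$W_K(t,q,u)=\sum_{i,j}t^iq^j\dim_{\mathbb{Q}}\widetilde{Kh}_{i,j}(\widehat K,p).$$
   Context: **Knotoids.** A knotoid diagram in $S^2$ is a generic immersion $K:[0,1]\to S^2$ whose only multiple points are transversal double points (crossings), each with over/under information; the images of $0$ and $1$ are the leg and the head, and $K$ is oriented from leg to head. A multi-knotoid diagram is defined the same way but may have additional (oriented) closed components, with still exactly one segment component. Let $n$ be the number of crossings of $K$, $n_\pm$ the number of positive/negative crossings. A shortcut is a generic immersed arc $\alpha$ in $S^2$ oriented from the leg to the head of $K$. **States.** The 0-smoothing of a crossing merges the two regions swept when the overstrand is rotated counterclockwise onto the understrand; the 1-smoothing merges the other two regions. A state is a function $s$ from the set of crossings to $\{0,1\}$, identified with the corresponding complete smoothing of $K$; $S(K)$ is the set of states. A state consists of one segment component $k_s$, oriented from leg to head, and some closed components; $|s|$ is the total number of components and $\|s\|=|s^{-1}(1)|$. Smoothings are done away from $\alpha\cap K$. $k_s\cdot\alpha$ (resp. $K\cdot\alpha$)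 is the number of times $k_s$ (resp. $K$, all components counted) crosses $\alpha$ from right to left minus the number of times from left to right, endpoints excluded. **Winding homology.** Order the crossings $c_1<\dots<c_n$. Let $\mathcal{V}_s$ be the $\mathbb{Q}$-vector space with ordered basis $s^{-1}(1)$. Let $\mathcal{A}=\mathbb{Q}[X]/(X^2)$, graded by $\deg 1=1$, $\deg X=-1$, additively on tensor products. Put $$C_i(K)=\bigoplus_{s\in S(K),\ \|s\|=i+n_-}\mathcal{A}^{\otimes(|s|-1)}\otimes X\mathcal{A}\otimes\bigwedge\nolimits^{\|s\|}\mathcal{V}_s,$$ where each closed component carries a copy of $\mathcal{A}$ and the segment component carries $X\mathcal{A}=\mathbb{Q}X$. A generator $v$ in the summand of $s$ has homological grading $i(v)=\|s\|-n_-$, $q$-grading $q(v)=\deg(v)+i(v)+n_+-n_-+1$, and $u$-grading $\mu(v)=k_s\cdot\alpha-K\cdot\alpha$. If $s,s'$ differ at exactly one crossing $c_0$, with $s(c_0)=0$, $s'(c_0)=1$, the edge map sends $v\otimes w\otimes x$ to $f(v)\otimes w\otimes(c_0\wedge x)$, where $v$ lies in the factors of the components changed at $c_0$, $w$ in the others, and $f$ is: multiplication $\mathcal{A}\otimes\mathcal{A}\to\mathcal{A}$ when two closed components merge; multiplication $\mathcal{A}\otimes X\mathcal{A}\to X\mathcal{A}$ when a closed component merges into the segment; $1\mapsto 1\otimes X+X\otimes 1$, $X\mapsto X\otimes X$ when a closed component divides; $X\mapsto X\otimes X\in\mathcal{A}\otimes X\mathcal{A}$ when a closed component splits off the segment;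 $0$ when the segment component changes into a segment component with the number of components unchanged. The differential $d$ is the sum of all edge maps. $H_{i,j}^k(K)$ is the homology of $(C(K),d)$ in homological grading $i$, $q$-grading $j$, $u$-grading $k$, and $W_K(t,q,u)=\sum_{i,j,k}t^iq^ju^k\dim_{\mathbb{Q}}H_{i,j}^k(K)$. **Reduced Khovanov homology.** $\widetilde{Kh}_{i,j}(\widehat K,p)$ is the homology of the Khovanov complex over $\mathbb{Q}$ in which, in each resolution, the component containing $p$ is assigned $X\mathcal{A}$ and each other component $\mathcal{A}$, with $i=\|s\|-n_-$ and $j=\deg+i+n_+-n_-+1$ (so the unknot has a single generator in bidegree $(0,0)$). *)

(* Defs.v *)
From HB Require Import structures.
From mathcomp Require Import all_boot all_order all_algebra.
From mathcomp Require Import mpoly.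

Set Implicit Arguments.
Unset Strict Implicit.
Unset Printing Implicit Defensive.

Import Order.TTheory GRing.Theory Num.Theory.
Local Open Scope ring_scope.

(* Diagrams in S^2, up to isotopy, are encoded as combinatorial maps.  The
   vertices are the crossings, the endpoints of the segment (if any) and
   possibly some bivalent points; the latter are harmless subdivision points,
   needed so that a closed component without crossings has a vertex.  A dart is
   one of the two halves of an edge; it is attached to a vertex and points away
   from it.  [opp] exchanges the two halves of an edge, [nxt d] is the dart
   following [d] counterclockwise around the vertex of [d], [crossing d] is the
   crossing at which [d] is attached, [over d] tells whether [d] belongs to the
   overstrand there, and [out d] whether the diagram is oriented away from the
   vertex along [d].  The crossings are 'I_ncr, hence come ordered; since all
   codes are considered, so are all orders. *)
Record code := Code {
  dart : finType;
  ncr : nat;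
  opp : dart -> dart;
  nxt : dart -> dart;
  crossing : dart -> option 'I_ncr;
  over : pred dart;
  out : pred dart
}.

Section Codes.
Variable D : code.
Implicit Types d e : dart D.

Record well_formed : Prop := WellFormed {
  oppK : involutive (@opp D);
  opp_neq : forall d, opp d != d;
  out_opp : forall d, out (opp d) = ~~ out d;
  nxt_inj : injective (@nxt D);
  crossing_surj : forall c : 'I_(ncr D), exists d, crossing d = Some c;
  crossing_nxt : forall d, crossing (nxt d) = crossing d;
  crossing_inj : forall d e, crossing d != None -> crossing d = crossing e ->
    fconnect (@nxt D) d e;
  crossing_vertex : forall d, crossing d != None ->
    [/\ order (@nxt D) d = 4%N, over (nxt d) = ~~ over d
      & out (nxt (nxt d)) = ~~ out d];
  other_vertex : forall d, crossing d = None ->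
    nxt d = d \/ order (@nxt D) d = 2%N /\ out (nxt d) = ~~ out d
}.

(* [reg d] is the region to the left of d, i.e. the one containing the corner
   between d and nxt d.  The face boundaries are the orbits of
   d |-> opp (nxt d), which keeps the region on the left.  Regions of a
   disconnected diagram may have several boundary walks.  Gluing to the ribbon
   graph of the code, for each region with b boundary walks, a sphere with b
   holes gives a closed oriented surface of Euler characteristic
     #vertices - #edges + \sum_regions (2 - b)
       = #vertices - #edges + 2 #regions - #(boundary walks);
   this surface is a sphere iff it is connected and this number is 2. *)
Record spherical (R : finType) (reg : dart D -> R) : Prop := Spherical {
  reg_face : forall d, reg (opp (nxt d)) = reg d;
  reg_surj : forall r, exists d, reg d = r;
  surface_connected : forall d e,
    connect [rel x y | [|| y == opp x, y == nxt x | reg x == reg y]] d e;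
  euler_sphere :
    (fcard (@nxt D) (dart D) + 2 * #|R| =
     fcard (@opp D) (dart D) + fcard (fun d => opp (nxt d)) (dart D) + 2)%N
}.

(* A crossing is positive iff a counterclockwise quarter turn takes the
   outgoing half of the overstrand to the outgoing half of the understrand. *)
Definition positive (c : 'I_(ncr D)) : bool :=
  [exists d, [&& crossing d == Some c, over d, out d & out (nxt d)]].
Definition npos : nat := #|[set c | positive c]|.
Definition nneg : nat := #|[set c | ~~ positive c]|.

Definition state := {ffun 'I_(ncr D) -> bool}.

Definition weight (s : state) : nat := #|[set c | s c]|.

(* The dart joined to d when the vertex of d is smoothed according to s.
   Rotating the overstrand counterclockwise sweeps the corners between an over
   dart d and nxt d; the 0-smoothing merges these corners, hence joins each
   over dart to the preceding (under) dart and each under dart to the next. *)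
Definition smooth (s : state) (d : dart D) : dart D :=
  if crossing d is Some c then
    if over d == s c then nxt d else finv (@nxt D) d
  else nxt d.

(* Components of the smoothing s, as sets of darts. *)
Definition component (s : state) (d : dart D) : {set dart D} :=
  [set e | connect [rel x y | (y == opp x) || (y == smooth s x)] d e].
Definition components (s : state) : {set {set dart D}} :=
  [set component s d | d : dart D].

(* The chain complex in which the component through the dart p carries X A and
   every other component carries A.  A basis element in the summand of s is a
   tensor of 1's and X's, given by the set of the components carrying 1,
   tensored with the generator of the top exterior power of V_s which is the
   wedge of s^-1(1) in increasing order. *)
Definition is_gen (p : dart D) (g : state * {set {set dart D}}) : bool :=
  (g.2 \subset components g.1) && (component g.1 p \notin g.2).

Definition gen (p : dart D) := {g : state * {set {set dart D}} | is_gen p g}.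

Section Generators.
Variable p : dart D.
Implicit Type g : gen p.

Definition gstate g : state := (val g).1.
Definition gones g : {set {set dart D}} := (val g).2.

Definition deg g : int :=
  #|gones g|%:Z - #|components (gstate g) :\: gones g|%:Z.

Definition hgrading g : int := (weight (gstate g))%:Z - nneg%:Z.

Definition qgrading g : int := deg g + hgrading g + npos%:Z - nneg%:Z + 1.

(* Coefficient of the basis tensor of g' in the image of that of g under
   f (x) id.  The components in both states keep their labels. *)
Definition edge_coef g g' : bool :=
  let old := components (gstate g) :\: components (gstate g') in
  let new := components (gstate g') :\: components (gstate g) in
  let ones_old := #|gones g :&: old| in
  let ones_new := #|gones g' :&: new| in
  (gones g :\: old == gones g' :\: new) &&
  (if (#|old| == 2%N) && (#|new| == 1%N) then
     (* 1 1 = 1,  1 X = X 1 = X,  X X = 0 *)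
     (ones_old, ones_new) \in [:: (2, 1); (1, 0)]%N
   else if (#|old| == 1%N) && (#|new| == 2%N) then
     (* 1 |-> 1 (x) X + X (x) 1,  X |-> X (x) X *)
     (ones_old, ones_new) \in [:: (1, 1); (0, 0)]%N
   else false).

Definition set1_state (s : state) (c0 : 'I_(ncr D)) : state :=
  [ffun c => (c == c0) || s c].

(* c0 /\ x = wedge_sign s c0 * (increasing wedge of s^-1(1) and c0), for x the
   increasing wedge of s^-1(1). *)
Definition wedge_sign (s : state) (c0 : 'I_(ncr D)) : rat :=
  (-1) ^+ #|[set c : 'I_(ncr D) | s c && (c < c0)%N]|.

Definition diff_coef g g' : rat :=
  \sum_(c0 | ~~ gstate g c0 && (gstate g' == set1_state (gstate g) c0))
    wedge_sign (gstate g) c0 * (edge_coef g g')%:R.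

Definition chain := {ffun gen p -> rat^o}.

Definition diff_fun (x : chain) : chain :=
  [ffun g' => \sum_g x g * diff_coef g g'].

Fact diff_fun_linear : linear diff_fun.
Proof.
move=> a x y; apply/ffunP=> g; rewrite !ffunE scaler_sumr -big_split /=.
by apply: eq_bigr => h _; rewrite !ffunE mulrDl -scalerAl.
Qed.
HB.instance Definition _ :=
  GRing.isLinear.Build rat chain chain _ diff_fun diff_fun_linear.

Definition diff : 'End(chain) := linfun diff_fun.

Definition span_of (P : pred (gen p)) : {vspace chain} :=
  <<[seq [ffun h => (h == g)%:R : rat^o] | g <- enum P]>>%VS.

(* Dimension of the homology at C = span P, of boundaries d (span Q): cycles in
   C modulo boundaries, the quotient Z / B being represented by a complement
   Z :\: B of B in Z. *)
Definition homology_dim (P Q : pred (gen p)) : nat :=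
  \dim ((lker diff :&: span_of P) :\: (diff @: span_of Q))%VS.

End Generators.

End Codes.

(* A (multi-)knotoid diagram in S^2.  The leg and the head are represented by
   the unique darts attached to them; as these are the only univalent vertices,
   there is exactly one segment component. *)
Record knotoid := Knotoid {
  kcode :> code;
  kleg : dart kcode;
  khead : dart kcode;
  region : finType;
  reg : dart kcode -> region;
  knotoid_wf : well_formed kcode;
  knotoid_endpoints : forall d, (nxt d == d) = (d == kleg) || (d == khead);
  out_kleg : out kleg;
  out_khead : ~~ out khead;
  knotoid_spherical : spherical reg
}.
Arguments kleg : clear implicits.
Arguments khead : clear implicits.
Arguments region : clear implicits.
Arguments reg {k} _.

(* A shortcut, recorded as the sequence of its intersections with the edges:
   the entry d stands for a crossing of the edge of d from the left of d (the
   region reg d) to its right (the region reg (opp d)).  Neither the arc inside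
   the regions nor its self-crossings matter to the winding homology. *)
Fixpoint crosses_to (K : knotoid) (r : region K) (w : seq (dart K))
    (r' : region K) : bool :=
  if w is d :: w' then (r == reg d) && crosses_to (reg (opp d)) w' r'
  else r == r'.

Record shortcut (K : knotoid) := Shortcut {
  crossed :> seq (dart K);
  crossedP : crosses_to (reg (kleg K)) crossed (reg (khead K))
}.

Section Winding.
Variables (K : knotoid) (alpha : shortcut K).

(* The darts along which k_s is travelled from leg to head: those met, starting
   from the leg, before turning back at the head. *)
Definition segment_darts (s : state K) : seq (dart K) :=
  let turn := orbit (fun d => smooth s (opp d)) (kleg K) in
  take (index (khead K) turn) turn.

(* If alpha goes from the left to the right of d, then a strand travelling
   along d goes from the right to the left of alpha. *)
Definition segment_dot (s : state K) : int :=
  \sum_(d <- crossed alpha)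
    ((d \in segment_darts s)%:Z - (opp d \in segment_darts s)%:Z).

Definition diagram_dot : int :=
  \sum_(d <- crossed alpha) ((out d)%:Z - (out (opp d))%:Z).

Definition ugrading (g : gen (kleg K)) : int :=
  segment_dot (gstate g) - diagram_dot.

Definition trigrading (g : gen (kleg K)) : int * int * int :=
  (hgrading g, qgrading g, ugrading g).

Definition winding_dim (i j k : int) : nat :=
  homology_dim [pred g | trigrading g == (i, j, k)]
               [pred g | trigrading g == (i - 1, j, k)].

End Winding.

(* Laurent polynomials in t, q, u, inside the field Q(t,q,u). *)
Definition tqu := {fraction {mpoly rat[3]}}.
Definition var_t : tqu := tofrac 'X_(inord 0).
Definition var_q : tqu := tofrac 'X_(inord 1).
Definition var_u : tqu := tofrac 'X_(inord 2).

(* The homology vanishes in the gradings of no generator, so that the sums may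
   be taken over the gradings of the generators. *)
Definition winding_poly (K : knotoid) (alpha : shortcut K) : tqu :=
  \sum_(m <- undup [seq trigrading alpha g | g : gen (kleg K)])
    var_t ^ m.1.1 * var_q ^ m.1.2 * var_u ^ m.2
      * (winding_dim alpha m.1.1 m.1.2 m.2)%:R.

Section Khovanov.
Variables (L : code) (p : dart L).

Definition bigrading (g : gen p) : int * int := (hgrading g, qgrading g).

Definition reduced_Kh_dim (i j : int) : nat :=
  homology_dim [pred g | bigrading g == (i, j)]
               [pred g | bigrading g == (i - 1, j)].

Definition reduced_Kh_poly : tqu :=
  \sum_(m <- undup [seq bigrading g | g : gen p])
    var_t ^ m.1 * var_q ^ m.2 * (reduced_Kh_dim m.1 m.2)%:R.

End Khovanov.

(* The link obtained by joining the head to the leg by an arc, which is a new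
   edge with halves inr true at the head and inr false at the leg.  The leg and
   the head become bivalent.  If there are several closed components in the
   common region of leg and head, the arc can pass them on either side, but
   this choice is not seen by the code. *)
Section Closure.
Variable K : knotoid.

Definition closure_opp (d : dart K + bool) : dart K + bool :=
  match d with inl d => inl (opp d) | inr b => inr (~~ b) end.

Definition closure_nxt (d : dart K + bool) : dart K + bool :=
  match d with
  | inl d => if d == kleg K then inr false
             else if d == khead K then inr true else inl (nxt d)
  | inr b => inl (if b then khead K else kleg K)
  end.

Definition closure : code :=
  @Code (dart K + bool)%type (ncr K) closure_opp closure_nxt
    (fun d => if d is inl e then crossing e else None)
    (fun d => if d is inl e then over e else false)
    (fun d => match d with inl e => out e | inr b => b end).

Definition base_point : dart closure := inr true.

Fact closure_wf : well_formed closure.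
Proof.
have [oK oN oO nI cS cN cI cV oV] := knotoid_wf K.
have ends d : (nxt d == d) = (d == kleg K) || (d == khead K).
  exact: knotoid_endpoints.
have lh : (khead K == kleg K) = false.
  by apply/negP=> /eqP e; have := out_khead K; rewrite e (out_kleg K).
have noncr (d : dart K) : nxt d = d -> crossing d = None.
  move=> nd; case cd: (crossing d) => [c|//].
  have cd' : crossing d != None by rewrite cd.
  have [o4 _ od] := cV _ cd'.
  by move: od; rewrite nd nd; case: (out d).
have nl : nxt (kleg K) = kleg K by apply/eqP; rewrite ends eqxx.
have nh : nxt (khead K) = khead K by apply/eqP; rewrite ends eqxx orbT.
have nends (d : dart K) : nxt d != d -> (nxt d == kleg K) = false /\ (nxt d == khead K) = false.
  move=> nd; split; apply/negP=> /eqP e; case/negP: nd; apply/eqP/nI.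
    by rewrite {1}e nl e.
  by rewrite {1}e nh e.
have inlN (d : dart K) : nxt d != d -> closure_nxt (inl d) = inl (nxt d).
  by rewrite ends negb_or => /andP[/negPf/= -> /negPf ->].
have nnn (d : dart K) : nxt d != d -> nxt (nxt d) != nxt d.
  by apply: contraNneq => /nI ->.
have iterN (d : dart K) k : nxt d != d -> iter k closure_nxt (inl d) = inl (iter k (@nxt K) d).
  move=> nd; suff [] : iter k closure_nxt (inl d) = inl (iter k (@nxt K) d)
    /\ nxt (iter k (@nxt K) d) != iter k (@nxt K) d by [].
  by elim: k => [|k [IH1 IH2]] //=; rewrite IH1 inlN //; split=> //; apply: nnn.
have nI' : injective closure_nxt.
  have gen (d : dart K) : [\/ d = kleg K, d = khead K | nxt d != d].
    have [|nd] := boolP (nxt d == d); last by constructor 3.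
    by rewrite ends => /orP[] /eqP; [constructor 1 | constructor 2].
  have eh : closure_nxt (inl (khead K)) = inr true by rewrite /= lh eqxx.
  have el : closure_nxt (inl (kleg K)) = inr false by rewrite /= eqxx.
  case=> [d|b] [e|b'].
  - case: (gen d) => [->|->|nd]; case: (gen e) => [->|->|ne] //;
      rewrite ?eh ?el ?inlN //.
    by case=> /nI ->.
  - case: (gen d) => [->|->|nd]; rewrite ?eh ?el ?inlN //=.
    by case=> E; case: (nends _ nd); case: b' E => ->; rewrite eqxx.
  - case: (gen e) => [->|->|ne]; rewrite ?eh ?el ?inlN //=.
    by case=> E; case: (nends _ ne); case: b E => <-; rewrite eqxx.
  - case: b b' => [] [] //= [] E.
      by move: lh; rewrite E eqxx.
    by move: lh; rewrite -E eqxx.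
have ordN (d : dart K) : nxt d != d -> order closure_nxt (inl d) = order (@nxt K) d.
  move=> nd; rewrite /order.
  rewrite -(card_imset _ (@inl_inj (dart K) bool)).
  apply: eq_card => x; rewrite !inE; apply/idP/imsetP.
    move=> /iter_findex <-; rewrite iterN //.
    by exists (iter (findex closure_nxt (inl d) x) (@nxt K) d); rewrite // inE fconnect_iter.
  by case=> y; rewrite inE => /iter_findex <- ->; rewrite -iterN // fconnect_iter.
have nmid (d : dart K) : crossing d != None -> nxt d != d.
  by apply: contraNneq => /noncr ->.
split=> /=.
- by case=> [d|b] /=; rewrite ?oK ?negbK.
- by case=> [d|[]] //=; apply: oN.
- by case=> [d|b] //=.
- exact: nI'.
- by move=> c; have [d cd] := cS c; exists (inl d).
- case=> [d|[]] /=; [|exact: noncr..].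
  case: eqP => [->|_]; first by rewrite noncr.
  by case: eqP => [->|_]; [rewrite noncr | apply: cN].
- case=> [d|b] [e|b'] //= cd; last by move=> /eqP E; move: cd; rewrite (eqP E).
  move=> /(cI _ _ cd)/iter_findex <-.
  by rewrite -iterN ?nmid // fconnect_iter.
- case=> [d|//] cd; have nd := nmid _ cd; have [o4 ov ou] := cV d cd.
  by rewrite /= -/(closure_nxt (inl d)) ordN // inlN // inlN ?nnn.
- have ord2 (x : dart K + bool) : closure_nxt x != x ->
      closure_nxt (closure_nxt x) = x -> order closure_nxt x = 2%N.
    move=> xN xK; rewrite (@order_cycle _ closure_nxt [:: x; closure_nxt x]) //.
    - by rewrite /= xK !eqxx.
    - by rewrite cons_uniq !inE eq_sym xN.
    - by rewrite inE eqxx.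
  case=> [d cd|b _]; last first.
    right; split; last by case: b => /=; rewrite ?out_kleg ?(negbTE (out_khead K)).
    by apply: ord2 => //; case: b; rewrite /= ?lh ?eqxx.
  case: (oV d cd) => [/eqP|[o2 od]]; last first.
    have nd : nxt d != d.
      by apply/eqP=> e; move: od; rewrite e; case: (out d).
    by right; rewrite -/(closure_nxt (inl d)) ordN // inlN.
  rewrite ends => /orP[] /eqP->; right; split=> //=.
  - by apply: ord2 => //=; rewrite eqxx.
  - by rewrite eqxx out_kleg.
  - by apply: ord2 => //=; rewrite ?lh eqxx.
  - by rewrite lh eqxx (negbTE (out_khead K)).
Qed.

Fact closure_no_endpoint (d : dart closure) : nxt d != d.
Proof.
case: d => [d|b] //; apply/eqP=> /=.
case: eqP => // /eqP dl; case: eqP => // /eqP dh [] /eqP.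
by rewrite knotoid_endpoints (negbTE dl) (negbTE dh).
Qed.

End Closure.

(* Main.v *)
From HB Require Import structures.
From mathcomp Require Import all_boot all_algebra.
From mathcomp Require Import ring lra zify.
Require Import Defs.

(** When leg and head lie in the same region, the two complexes are the same
    up to renaming the generators, and the third grading is zero; nothing is
    said about homology beyond the fact that isomorphic complexes have homology
    of the same dimension.

    The u-grading vanishes.  The segment component k_s and the diagram K, as
    oriented 1-chains, both have boundary head - leg, up to sign: k_s by
    telescoping along its darts ([segment_flow]), K because a strand traverses
    each crossing ([diagram_flow]).  Hence k_s - K is a 1-cycle on the sphere,
    and it is the coboundary of a potential h on the regions
    ([circulation_region_potential]).  The shortcut alpha then counts
    h(region of the head) - h(region of the leg), which is 0 here
    ([ugrading_knot_type]).

    The existence of the potential is H_1(S^2; Q) = 0, obtained from Euler's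
    formula by counting dimensions.  All spaces are realised inside the
    functions on darts: functions on vertices, faces or edges are functions
    (anti)invariant under a permutation of the darts.  The coboundaries of vertex
    functions and of region functions are orthogonal, and Euler's formula says
    that together they fill the antisymmetric functions; a cycle is orthogonal
    to the first kind, hence of the second kind.

    The complexes agree.  A smoothing of the closure is a smoothing of K with an
    arc added from head to leg.  Since k_s already runs from leg to head
    ([travel_leg_head]), contracting this arc ([retract]) identifies the
    components of the two smoothings, the component of the base point with k_s.
    This bijection of generators respects gradings and matrix coefficients, so
    the homologies have the same dimensions ([winding_dim_closure]), and the
    Poincare polynomials agree term by term. *)

Set Implicit Arguments.
Unset Strict Implicit.
Unset Printing Implicit Defensive.

Import GRing.Theory Num.Theory.
Local Open Scope ring_scope.

(** * Spaces of functions on a finite type *)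

(* The codomain is [rat^o], as for the chains, so that the spaces of chains are
   among these spaces. *)
Notation fspace T := {ffun T -> rat^o}.

Section Pullback.
Variables (S T : finType) (h : S -> T).

Definition pull_fun (x : fspace T) : fspace S := [ffun s => x (h s)].

Fact pull_fun_linear : linear pull_fun.
Proof. by move=> a x y; apply/ffunP=> s; rewrite !ffunE. Qed.
HB.instance Definition _ :=
  GRing.isLinear.Build rat (fspace T) (fspace S) _ pull_fun pull_fun_linear.

Definition pull : 'Hom(fspace T, fspace S) := linfun pull_fun.

Lemma pullE x s : pull x s = x (h s).
Proof. by rewrite lfunE ffunE. Qed.

Lemma dim_fspace : \dim {:fspace T} = #|T|.
Proof. by rewrite dimvf /dim /= muln1. Qed.

End Pullback.

Lemma dim_limg_pull (S T : finType) (h : S -> T) :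
  (forall t, exists s, h s = t) -> \dim (limg (pull h)) = #|T|.
Proof.
move=> h_surj; rewrite -[RHS]dim_fspace; apply: limg_dim_eq; apply/eqP.
rewrite -subv0; apply/subvP=> x; rewrite memv_cap memv_ker memv0 => /andP[_ /eqP x0].
by apply/eqP/ffunP=> t; have [s <-] := h_surj t; rewrite -pullE x0 !ffunE.
Qed.

(** Restriction to A embeds U into the functions on A. *)
Lemma dim_le_support (T : finType) (A : {pred T}) (U : {vspace fspace T}) :
  (forall x, x \in U -> (forall t, t \in A -> x t = 0) -> x = 0) ->
  (\dim U <= #|A|)%N.
Proof.
move=> U0; pose r := pull (fun t : {t : T | t \in A} => val t).
have <- : \dim (r @: U)%VS = \dim U.
  apply: limg_dim_eq; apply/eqP; rewrite -subv0; apply/subvP=> x.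
  rewrite memv_cap memv_ker memv0 => /andP[xU /eqP x0]; apply/eqP/U0 => // t tA.
  have := pullE (fun t : {t : T | t \in A} => val t) x (exist _ t tA).
  by rewrite -/r x0 ffunE.
have <- : \dim {:fspace {t : T | t \in A}} = #|A|.
  by rewrite dim_fspace; exact: card_sig.
exact/dimvS/subvf.
Qed.

Section Invariants.
Variables (T : finType) (f : T -> T).
Implicit Type x : fspace T.

Definition difference : 'End(fspace T) := pull f - \1%VF.
Definition invariants : {vspace fspace T} := lker difference.
Definition antiinvariants : {vspace fspace T} := lker (pull f + \1%VF).

Lemma differenceE x t : difference x t = x (f t) - x t.
Proof. by rewrite add_lfunE opp_lfunE id_lfunE !ffunE pullE. Qed.

Lemma invariantsP x : reflect (forall t, x (f t) = x t) (x \in invariants).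
Proof.
rewrite memv_ker; apply: (iffP eqP) => [x0 t|xf].
  by apply/eqP; rewrite -subr_eq0 -differenceE x0 ffunE.
by apply/ffunP=> t; rewrite differenceE xf subrr ffunE.
Qed.

Lemma antiinvariantsP x :
  reflect (forall t, x (f t) = - x t) (x \in antiinvariants).
Proof.
have sumE t : (pull f + \1%VF) x t = x (f t) + x t.
  by rewrite add_lfunE id_lfunE !ffunE pullE.
rewrite memv_ker; apply: (iffP eqP) => [x0 t|xf].
  by apply/eqP; rewrite -addr_eq0 -sumE x0 ffunE.
by apply/ffunP=> t; rewrite sumE xf addNr ffunE.
Qed.

Hypothesis f_inj : injective f.

Lemma froot_im t : froot f (f t) = froot f t.
Proof.
apply/eqP; rewrite root_connect; last exact: fconnect_sym.
by rewrite fconnect_sym // fconnect1.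
Qed.

Lemma invariant_fconnect x t u : x \in invariants -> fconnect f t u -> x u = x t.
Proof. by move=> /invariantsP xf /iter_findex <-; elim: findex => //= n <-. Qed.

(** An invariant function is a function on the set of orbits, represented by
    their roots. *)
Lemma dim_invariants : \dim invariants = fcard f T.
Proof.
have sym : connect_sym (frel f) by exact: fconnect_sym.
have Ecard : fcard f T = #|froots f| by apply: eq_card => t; rewrite !inE andbT.
apply/eqP; rewrite eqn_leq Ecard; apply/andP; split.
  apply: dim_le_support => x xI x0; apply/ffunP=> t; rewrite ffunE.
  rewrite -(x0 (froot f t)); last by rewrite unfold_in; apply: (roots_root sym).
  by apply/esym/invariant_fconnect => //; apply: connect_root.
pose h t : {r : T | r \in froots f} := exist _ (froot f t) (roots_root sym t).
apply: (@leq_trans (\dim (limg (pull h)))).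
  rewrite dim_limg_pull => [|[r rr]]; first by rewrite card_sig.
  by exists r; apply: val_inj => /=; apply/eqP.
apply/dimvS/subvP=> _ /memv_imgP[y _ ->]; apply/invariantsP=> t.
by rewrite !pullE; congr (y _); apply: val_inj; apply: froot_im.
Qed.

(** Only an inequality: an orbit of odd length carries no nonzero
    antiinvariant function. *)
Lemma dim_antiinvariants : (\dim antiinvariants <= fcard f T)%N.
Proof.
have sym : connect_sym (frel f) by exact: fconnect_sym.
have -> : fcard f T = #|froots f| by apply: eq_card => t; rewrite !inE andbT.
apply: dim_le_support => x /antiinvariantsP xA x0; apply/ffunP=> t; rewrite ffunE.
have rt : fconnect f (froot f t) t by rewrite sym connect_root.
rewrite -(iter_findex rt); elim: findex => [|n] /=.
  by apply: x0; rewrite unfold_in; apply: (roots_root sym).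
by rewrite xA => ->; rewrite oppr0.
Qed.

End Invariants.

(** * Circulations on a spherical diagram *)

Section Sphere.
Variables (D : code) (R : finType) (reg : dart D -> R).
Hypotheses (oppI : involutive (@opp D)) (nxtI : injective (@nxt D)).
Hypothesis sph : spherical reg.
Implicit Types x a : fspace (dart D).
Notation V := (invariants (@nxt D)).
Notation delta := (difference (@opp D)).

(** The 1-cycles: orthogonality to the functions on vertices says that the sum
    of x over the darts at each vertex is zero. *)
Definition circulation (x : fspace (dart D)) :=
  (forall d, x (opp d) = - x d) /\
  (forall a, a \in V -> \sum_d x d * a d = 0).

Lemma coboundary_anti a d : delta a (opp d) = - delta a d.
Proof. by rewrite !differenceE oppI opprB. Qed.

(** A circulation that comes from a potential on the vertices is orthogonal to
    itself: summation by parts turns its square norm into a pairing with the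
    potential. *)
Lemma circulation_potential0 x a :
  circulation x -> a \in V -> x = delta a -> x = 0.
Proof.
move=> [xA x0] aV xa.
have: \sum_d x d * x d = 0.
  rewrite {2}xa; under eq_bigr => d _ do rewrite differenceE mulrBr.
  rewrite sumrB x0 // subr0 (reindex_inj (inv_inj oppI)) /=.
  under eq_bigr => d _ do rewrite oppI xA mulNr.
  by rewrite sumrN x0 // oppr0.
move/psumr_eq0P=> x2; apply/ffunP=> d; rewrite ffunE.
by apply/eqP; rewrite -sqrf_eq0 expr2 x2 // => e _; rewrite -expr2 sqr_ge0.
Qed.

Definition region_functions : {vspace fspace (dart D)} := limg (pull reg).

Lemma region_functionsP x :
  reflect (exists h : R -> rat, forall d, x d = h (reg d))
          (x \in region_functions).
Proof.
apply: (iffP idP) => [/memv_imgP[h _ ->]|[h xh]].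
  by exists h => d; rewrite pullE.
apply/memv_imgP; exists [ffun r => h r]; rewrite ?memvf //.
by apply/ffunP=> d; rewrite pullE ffunE xh.
Qed.

(** Around a vertex, the regions on the two sides of successive darts cancel in
    pairs, as [reg_face] identifies the right side of [nxt d] with the left side
    of [d]. *)
Lemma region_coboundary_circulation x :
  x \in region_functions -> circulation (delta x).
Proof.
move=> /region_functionsP[h xh]; split=> [d|a /invariantsP aV].
  exact: coboundary_anti.
under eq_bigr => d _ do rewrite differenceE mulrBl.
rewrite sumrB (reindex_inj nxtI) -sumrB big1 // => d _ /=.
by rewrite aV !xh (reg_face sph) subrr.
Qed.

(** The functions that descend both to the regions and to the connected
    components of the underlying graph; there is only one such function up to
    scalars because the surface is connected. *)
Lemma constant_of_invariant x :
  (forall d e, reg d = reg e -> x d = x e) -> (forall d, x (opp d) = x d) ->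
  (forall d, x (nxt d) = x d) ->
  forall d e : dart D, x d = x e :> rat.
Proof.
move=> xr xo xn d e; have /connectP[p] := surface_connected sph d e.
elim: p d => [|f p IH] d /= => [_ -> //|/andP[df pp] ep].
rewrite -(IH f pp ep); case/or3P: df => /eqP; [move-> | move-> |exact: xr].
  by rewrite xo.
by rewrite xn.
Qed.

(** Let v, e, f, r be the numbers of vertices, edges, boundary walks and
    regions, and c the number of connected components of the graph.  The
    coboundaries of vertex functions have dimension v - c, those of region
    functions at least r - 1, and the two spaces meet in 0 by
    [circulation_potential0].  Functions on components and functions on regions
    are both functions on boundary walks and have only the constants in common,
    so c + r - 1 <= f.  With v - e + 2r - f = 2 this gives
    (v - c) + (r - 1) >= e, so that every antisymmetric function is a sum
    delta a + delta y, with a on vertices and y on regions.  For a circulation,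
    delta a is a circulation too, hence zero. *)
Theorem circulation_region_potential x :
  circulation x -> exists h : R -> rat, forall d, x d = h (reg (opp d)) - h (reg d).
Proof.
move=> cx; pose Rf := region_functions.
have [d0 _|D0] := pickP (dart D); last by exists (fun=> 0) => d; have := D0 d.
have le1 (U : {vspace fspace (dart D)}) :
    (forall y, y \in U -> forall d e, y d = y e) -> (\dim U <= 1)%N.
  move=> Uc; rewrite -(card1 d0); apply: dim_le_support => y /Uc yc y0.
  by apply/ffunP=> d; rewrite (yc d d0) y0 ?inE ?ffunE.
have face y d : y \in Rf -> y (opp (nxt d)) = y d.
  by move=> /region_functionsP[h yh]; rewrite !yh (reg_face sph).
have dimR : \dim Rf = #|R| := dim_limg_pull (reg_surj sph).
have dimV : \dim V = fcard (@nxt D) (dart D) := dim_invariants nxtI.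
(* C consists of the functions on the connected components of the graph. *)
pose C := (V :&: lker delta)%VS.
have CP y : y \in C -> (forall d, y (nxt d) = y d) /\ (forall d, y (opp d) = y d).
  by rewrite memv_cap => /andP[/invariantsP yn /invariantsP yo].
have dimVd : (\dim C + \dim (delta @: V) = \dim V)%N := limg_ker_dim _ _.
have dimRd : (\dim (Rf :&: lker delta) + \dim (delta @: Rf) = \dim Rf)%N :=
  limg_ker_dim _ _.
have k1 : (\dim (Rf :&: lker delta) <= 1)%N.
  apply: le1 => y; rewrite memv_cap => /andP[yR /invariantsP yo].
  apply: constant_of_invariant => // [d e de|d].
    by have /region_functionsP[h yh] := yR; rewrite !yh de.
  by rewrite -yo face.
have dimCR : (\dim (C + Rf) + \dim (C :&: Rf) = \dim C + \dim Rf)%N :=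
  dimv_sum_cap _ _.
have k2 : (\dim (C :&: Rf) <= 1)%N.
  apply: le1 => y; rewrite memv_cap => /andP[/CP[yn yo] /region_functionsP[h yh]].
  by apply: constant_of_invariant => // d e de; rewrite !yh de.
have leF : (\dim (C + Rf) <= fcard (fun d : dart D => opp (nxt d)) (dart D))%N.
  rewrite -dim_invariants; last by move=> d e /(inv_inj oppI)/nxtI.
  apply/dimvS/subvP=> _ /memv_addP[y /CP[yn yo] [z zR ->]].
  by apply/invariantsP=> d; rewrite !ffunE yo yn face.
have dimS : (\dim (delta @: V + delta @: Rf) =
    \dim (delta @: V) + \dim (delta @: Rf))%N.
  apply: dimv_disjoint_sum; apply/eqP; rewrite -subv0; apply/subvP=> y.
  rewrite memv_cap memv0 => /andP[/memv_imgP[a aV ya] /memv_imgP[z zR yz]].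
  apply/eqP/(circulation_potential0 _ aV ya); rewrite yz.
  exact: region_coboundary_circulation.
have leE := dim_antiinvariants (inv_inj oppI).
have := euler_sphere sph; rewrite -dimV -dimR => eul.
have count (v e f r c dv dr k cr k' s a : nat) :
    (c + dv = v -> k + dr = r -> k <= 1 -> cr + k' = c + r -> k' <= 1 ->
     cr <= f -> s = dv + dr -> a <= e -> v + 2 * r = e + f + 2 -> a <= s)%N.
  by lia.
have sub : (delta @: V + delta @: Rf <= antiinvariants (@opp D))%VS.
  apply/subvP=> _ /memv_addP[_ /memv_imgP[a _ ->] [_ /memv_imgP[b _ ->] ->]].
  by apply/antiinvariantsP=> d; rewrite !ffunE !coboundary_anti opprD.
have xE : x \in (delta @: V + delta @: Rf)%VS.
  have -> : (delta @: V + delta @: Rf)%VS = antiinvariants (@opp D).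
    apply/eqP; rewrite eqEdim sub /=.
    exact: count dimVd dimRd k1 dimCR k2 leF dimS leE eul.
  by apply/antiinvariantsP; have [] := cx.
have [_ /memv_imgP[a aV ->] [_ /memv_imgP[y yR ->] xay]] := memv_addP xE.
have xy : x = delta y.
  apply/eqP; rewrite -subr_eq0; apply/eqP/(circulation_potential0 _ aV); last first.
    by rewrite xay addrK.
  have [yA y0] := region_coboundary_circulation yR; have [xA x0] := cx.
  split=> [d|b bV]; first by rewrite !ffunE xA yA opprD.
  rewrite (eq_bigr (fun d => x d * b d - delta y d * b d)); last first.
    by move=> d _; rewrite !ffunE mulrBl.
  by rewrite sumrB x0 // y0 // subr0.
have /region_functionsP[h yh] := yR.
by exists h => d; rewrite xy differenceE !yh.
Qed.

End Sphere.

(** * Smoothings *)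

Section Smoothing.
Variable D : code.
Hypothesis wf : well_formed D.
Variable s : state D.

Lemma crossing_moves (d : dart D) : crossing d != None -> nxt d != d.
Proof.
move=> /(crossing_vertex wf)[_ ov _]; apply/eqP=> nd.
by move: ov; rewrite nd; case: (over d).
Qed.

Lemma smoothK : involutive (smooth s).
Proof.
have nI := nxt_inj wf; have cn := crossing_nxt wf.
move=> d; rewrite {2}/smooth; case cd: (crossing d) => [c|]; last first.
  rewrite /smooth cn cd; case: (other_vertex wf cd) => [nd|[o2 _]].
    by rewrite !nd.
  by have := iter_order nI d; rewrite o2.
have ov e : crossing e = Some c -> over (nxt e) = ~~ over e.
  by move=> ce; have [|_ -> _] := crossing_vertex wf (d := e); rewrite ?ce.
case: eqP => od.
  by rewrite /smooth cn cd ov // -od; case: (over d); rewrite /= finv_f.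
have [e de] : exists e, d = nxt e by exists (finv (@nxt D) d); rewrite f_finv.
have ce : crossing e = Some c by rewrite -cd de cn.
rewrite de finv_f // /smooth ce; case: eqP => // oe; case: od.
by rewrite de ov //; case: (over e) (s c) oe => [] [] // [].
Qed.

Lemma smooth_nxt d : fconnect (@nxt D) d (smooth s d).
Proof.
rewrite /smooth; case: crossing => [c|]; last exact: fconnect1.
by case: ifP => _; [apply: fconnect1 | apply: fconnect_finv].
Qed.

Lemma smooth_fixed d : smooth s d = d -> nxt d = d.
Proof.
rewrite /smooth; case cd: crossing => [c|] //; case: ifP => // _ fd.
by rewrite -[RHS](f_finv (nxt_inj wf)) fd.
Qed.

Lemma invariant_smooth (a : fspace (dart D)) d :
  a \in invariants (@nxt D) -> a (smooth s d) = a d.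
Proof. by move=> aV; apply: (invariant_fconnect aV); apply: smooth_nxt. Qed.

Lemma smooth_connect_sym :
  connect_sym [rel x y | (y == opp x) || (y == smooth s x)].
Proof.
have swap (f : dart D -> dart D) x y : involutive f -> (y == f x) = (x == f y).
  by move=> fK; rewrite eq_sym (can2_eq fK fK).
apply: sym_connect_sym => x y /=.
by rewrite (swap _ _ _ (oppK wf)) (swap _ _ _ smoothK).
Qed.

End Smoothing.

(** A walk that alternates two involutions f and g from a fixed point x of f
    ends at another fixed point of f.  Indeed f reverses the orbit of x under
    h = f g, sending the k-th point to the (n - k)-th for n the length of the
    orbit.  If n is even the midpoint is fixed by f; if n is odd the two middle
    points are exchanged by f, and the first of them is fixed by g: excluded. *)
Lemma involutions_orbit_fixpoint (T : finType) (f g : T -> T) (x : T) :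
  involutive f -> involutive g -> (forall y, g y != y) -> f x = x ->
  let h y := f (g y) in exists m, [/\ (0 < m < order h x)%N,
    iter m h x != x & f (iter m h x) = iter m h x].
Proof.
move=> fK gK gN fx h; set n := order h x.
have hI : injective h := inj_comp (inv_inj fK) (inv_inj gK).
have refl k : (k <= n)%N -> f (iter k h x) = iter (n - k) h x.
  elim: k => [|k IH] ltkn; first by rewrite subn0 iter_order.
  have /(inv_inj fK) xk : f (iter k h x) = f (g (iter (n - k.+1) h x)).
    by rewrite IH ?(ltnW ltkn) // -(subnSK ltkn).
  by rewrite /= {1}/h xk gK fK.
have n0 : (0 < n)%N := order_gt0 _ _.
have n2 := odd_double_half n; set m := n./2 in n2.
case: (boolP (odd n)) n2 => [_|_]; rewrite ?add0n -addnn => n2; last first.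
  have m0 : (0 < m)%N by lia.
  have mn : (m < n)%N by lia.
  exists m; split; first by rewrite m0 mn.
    by apply/eqP=> xm; move: (findex_iter mn); rewrite xm findex0; lia.
  by rewrite refl; [congr iter; lia | lia].
have mn : (m.+1 <= n)%N by lia.
have gm : g (iter m h x) = iter m h x.
  by rewrite -[LHS]fK -[f (g _)]/(iter m.+1 h x) refl //; congr iter; lia.
by have := gN (iter m h x); rewrite gm eqxx.
Qed.

(** * The u-grading *)

Section Grading.
Variables (K : knotoid) (alpha : shortcut K).
Implicit Types (s : state K) (d : dart K) (a : fspace (dart K)).
Let wf := knotoid_wf K.

(** One step along a component of the smoothing: cross the edge of d, then leave
    its other end by the dart joined there. *)
Definition travel s d := smooth s (opp d).

Lemma leg_end : nxt (kleg K) = kleg K.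
Proof. by apply/eqP; rewrite knotoid_endpoints eqxx. Qed.

Lemma head_end : nxt (khead K) = khead K.
Proof. by apply/eqP; rewrite knotoid_endpoints eqxx orbT. Qed.

Lemma leg_neq_head : kleg K != khead K.
Proof. by apply/eqP=> e; have := out_khead K; rewrite -e out_kleg. Qed.

Lemma end_crossing d : nxt d = d -> crossing d = None.
Proof.
by move=> nd; apply/eqP; apply: contraTT (introT eqP nd) => /(crossing_moves wf).
Qed.

Lemma smooth_end s d : nxt d = d -> smooth s d = d.
Proof. by move=> nd; rewrite /smooth end_crossing. Qed.

(** Leg and head are the only fixed points of [smooth s], so that the walk from
    the leg ends at the head. *)
Lemma travel_leg_head s : exists2 m,
  iter m (travel s) (kleg K) = khead K & segment_darts s = traject (travel s) (kleg K) m.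
Proof.
have [m [/andP[_ mn] mN mF]] := involutions_orbit_fixpoint (smoothK wf s) (oppK wf)
  (opp_neq wf) (smooth_end s leg_end).
have mh : iter m (travel s) (kleg K) = khead K.
  by have /eqP := smooth_fixed wf mF; rewrite knotoid_endpoints (negPf mN) => /eqP.
exists m => //; rewrite /segment_darts -/(travel s).
have -> : index (khead K) (orbit (travel s) (kleg K)) = m.
  rewrite -mh -(nth_traject _ mn) index_uniq ?size_orbit //.
  exact: orbit_uniq.
by rewrite take_traject // ltnW.
Qed.

(** The boundary of k_s, tested against the functions on vertices: the sum
    telescopes along the walk, since the darts d and [smooth s d] have the same
    vertex. *)
Lemma segment_flow s a : a \in invariants (@nxt K) ->
  \sum_d ((d \in segment_darts s)%:R - (opp d \in segment_darts s)%:R) * a d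
    = a (kleg K) - a (khead K).
Proof.
move=> aV; under eq_bigr => d _ do rewrite mulrBl.
rewrite sumrB [X in _ - X](reindex_inj (inv_inj (oppK wf))) -sumrB /=.
have uniq_seg : uniq (segment_darts s) by rewrite take_uniq ?orbit_uniq.
rewrite (eq_bigr (fun d => if d \in segment_darts s then a d - a (travel s d) else 0));
  last first.
  move=> d _; rewrite (oppK wf) /travel invariant_smooth //.
  by case: ifP => _; rewrite ?mul1r ?mul0r ?subr0.
rewrite -big_mkcond /= -big_uniq //.
have [m <- ->] := travel_leg_head s.
elim: m (kleg K) => [|m IH] d; first by rewrite big_nil subrr.
by rewrite trajectS big_cons IH -iterSr; apply: subrKA.
Qed.

(** The boundary of K, tested against the functions on vertices: away from the
    endpoints the two darts of a strand at a vertex contribute opposite signs. *)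
Lemma diagram_flow a : a \in invariants (@nxt K) ->
  \sum_d ((out d)%:R - (out (opp d))%:R) * a d = a (kleg K) - a (khead K).
Proof.
move=> aV; have an := elimT (invariantsP _ _) aV.
have nI := nxt_inj wf; have cn := crossing_nxt wf.
(* The flow of K, corrected by its boundary at the two endpoints. *)
pose e d : rat := (out d)%:R - (out (opp d))%:R - (d == kleg K)%:R + (d == khead K)%:R.
(* The other dart of the same strand at the vertex of d. *)
pose across d := if crossing d is Some _ then nxt (nxt d) else nxt d.
have acrossI : injective across.
  move=> d d'; rewrite /across; case cd: crossing => [c|]; case cd': crossing => [c'|].
  - by move=> /nI/nI.
  - by move=> /nI dd'; rewrite -dd' cn cd in cd'.
  - by move=> /nI dd'; rewrite dd' cn cd' in cd.
  - by move=> /nI.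
have inner d : nxt d != d -> e d = (out d)%:R - (~~ out d)%:R.
  rewrite knotoid_endpoints negb_or => /andP[/negPf dl /negPf dh].
  by rewrite /e dl dh subr0 addr0 (out_opp wf).
have eN d : e (across d) = - e d.
  have nnn d' : nxt d' != d' -> nxt (nxt d') != nxt d' by apply: contraNneq => /nI ->.
  rewrite /across; case cd: (crossing d) => [c|].
    have [|_ _ od] := crossing_vertex wf (d := d); first by rewrite cd.
    have nd : nxt d != d by apply: (crossing_moves wf); rewrite cd.
    by rewrite !inner ?nnn // od negbK opprB.
  case: (other_vertex wf cd) => [nd|[_ od]].
    have : (d == kleg K) || (d == khead K) by rewrite -knotoid_endpoints nd.
    rewrite nd /e (out_opp wf).
    case/orP=> /eqP ->; rewrite eqxx ?(negPf leg_neq_head) ?[_ == kleg K]eq_sym.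
      by rewrite out_kleg subrr oppr0.
    by rewrite (negPf leg_neq_head) (negPf (out_khead K)); lra.
  have nd : nxt d != d by apply/eqP=> nd; move: od; rewrite nd; case: (out d).
  by rewrite !inner ?nnn // od negbK opprB.
have e0 : \sum_d e d * a d = 0.
  have : \sum_d e d * a d = - (\sum_d e d * a d).
    rewrite {1}(reindex_inj acrossI) /= -sumrN; apply: eq_bigr => d _.
    by rewrite eN mulNr /across; case: crossing => *; rewrite !an.
  by move=> ?; lra.
have -> : \sum_d ((out d)%:R - (out (opp d))%:R) * a d =
    \sum_d (e d * a d + (if d == kleg K then a d else 0)
       - (if d == khead K then a d else 0)).
  apply: eq_bigr => d _; rewrite /e.
  by case: (d == kleg K); case: (d == khead K) => /=; ring.
by rewrite sumrB big_split /= e0 add0r -!big_mkcond !big_pred1_eq.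
Qed.

Lemma shortcut_potential (h : region K -> rat) r r' w :
  crosses_to r w r' -> \sum_(d <- w) (h (reg (opp d)) - h (reg d)) = h r' - h r.
Proof.
elim: w r => [|d w IH] r /=; first by move=> /eqP ->; rewrite big_nil subrr.
by move=> /andP[/eqP -> /IH]; rewrite big_cons => ->; rewrite addrC subrKA.
Qed.

Lemma ugrading_potential s : exists h : region K -> rat,
  (segment_dot alpha s - diagram_dot alpha)%:~R = h (reg (khead K)) - h (reg (kleg K)).
Proof.
pose x : fspace (dart K) :=
  [ffun d => (d \in segment_darts s)%:R - (opp d \in segment_darts s)%:R
             - ((out d)%:R - (out (opp d))%:R)].
have cx : circulation x.
  split=> [d|a aV]; first by rewrite !ffunE (oppK wf); ring.
  rewrite (eq_bigr (fun d => ((d \in segment_darts s)%:R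
     - (opp d \in segment_darts s)%:R) * a d - ((out d)%:R - (out (opp d))%:R) * a d)).
    by rewrite sumrB segment_flow // diagram_flow // subrr.
  by move=> d _; rewrite ffunE mulrBl.
have [h xh] := circulation_region_potential (oppK wf) (nxt_inj wf) (knotoid_spherical K) cx.
exists h; rewrite -(shortcut_potential h (crossedP alpha)).
rewrite rmorphB !rmorph_sum /= -sumrB; apply: eq_bigr => d _.
by rewrite -xh ffunE !rmorphB.
Qed.

End Grading.

(** The potential of k_s - K takes the same value at both ends of the
    shortcut. *)
Theorem ugrading_knot_type (K : knotoid) (alpha : shortcut K) g :
  reg (kleg K) = reg (khead K) -> ugrading alpha g = 0.
Proof.
move=> lh; have [h hE] := ugrading_potential alpha (gstate g).
by apply/eqP; rewrite -(intr_eq0 rat) /ugrading hE lh subrr.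
Qed.

(** * Homology of isomorphic complexes *)

Section HomologyIso.
Variables (D D' : code) (p : dart D) (p' : dart D').
Variables (h : gen p -> gen p') (h' : gen p' -> gen p).
Hypotheses (hK : cancel h h') (h'K : cancel h' h).
Hypothesis diffE : forall g1 g2, diff_coef (h g1) (h g2) = diff_coef g1 g2.

Notation iso := (pull h').

Let iso_ker0 : lker iso == 0%VS.
Proof.
apply/lker0P=> x y /ffunP xy; apply/ffunP=> g.
by have := xy (h g); rewrite !pullE hK.
Qed.

Let dim_iso (U : {vspace chain p}) : \dim (iso @: U) = \dim U.
Proof. by apply: limg_dim_eq; rewrite (eqP iso_ker0) capv0. Qed.

Let iso_diff x : iso (diff p x) = diff p' (iso x).
Proof.
apply/ffunP=> g'; rewrite pullE !lfunE !ffunE /=.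
rewrite [RHS](reindex h) /=; last by exists h' => ? _; rewrite ?hK ?h'K.
by apply: eq_bigr => g _; rewrite ffunE hK -diffE h'K.
Qed.

Let iso_span (P : pred (gen p)) (P' : pred (gen p')) :
  (forall g, P' (h g) = P g) -> (iso @: span_of P = span_of P')%VS.
Proof.
move=> PP'; rewrite limg_span; apply: eq_span => x; rewrite -map_comp.
have isoE g : iso [ffun k => (k == g)%:R] = [ffun k => (k == h g)%:R].
  by apply/ffunP=> k; rewrite pullE !ffunE (can2_eq h'K hK).
have enumE g : (h g \in enum P') = (g \in enum P) by rewrite !mem_enum; exact: PP'.
apply/mapP/mapP=> -[g gP ->].
  by exists (h g); rewrite ?enumE //= isoE.
by exists (h' g); rewrite -?enumE /= ?isoE h'K.
Qed.

Lemma homology_dim_iso (P Q : pred (gen p)) (P' Q' : pred (gen p')) :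
  (forall g, P' (h g) = P g) -> (forall g, Q' (h g) = Q g) ->
  homology_dim P Q = homology_dim P' Q'.
Proof.
move=> PP' QQ'; rewrite /homology_dim -(iso_span PP') -(iso_span QQ').
set Z := (_ :&: span_of P)%VS; set B := (diff p @: _)%VS.
have -> : (diff p' @: (iso @: span_of Q) = iso @: B)%VS.
  rewrite /B -!limg_comp; congr (_ @: _)%VS.
  by apply/lfunP=> x; rewrite !comp_lfunE iso_diff.
have -> : (lker (diff p') :&: iso @: span_of P = iso @: Z)%VS.
  apply/vspaceP=> y; rewrite memv_cap memv_ker; apply/andP/memv_imgP.
    case=> dy /memv_imgP[x xP yx]; exists x => //; rewrite memv_cap xP memv_ker andbT.
    by rewrite -(inj_eq (elimT lker0P iso_ker0)) linear0 iso_diff -yx.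
  case=> x; rewrite memv_cap memv_ker => /andP[/eqP dx xP] ->.
  by rewrite -iso_diff dx linear0 eqxx memv_img.
have := dimv_cap_compl (iso @: Z) (iso @: B); have := dimv_cap_compl Z B.
rewrite -lker0_img_cap // !dim_iso => <-.
by move/eqP; rewrite eqn_add2l => /eqP.
Qed.

End HomologyIso.

(** * The complex of the closure *)

Lemma imsetD_inj (aT rT : finType) (f : aT -> rT) (A B : {set aT}) :
  injective f -> f @: (A :\: B) = f @: A :\: f @: B.
Proof.
move=> fI; apply/setP=> y; rewrite inE; apply/imsetP/andP=> [[x]|[yB /imsetP[x xA yx]]].
  by rewrite inE => /andP[xB xA] ->; rewrite !mem_imset.
by exists x; rewrite // inE xA andbT; move: yB; rewrite yx mem_imset.
Qed.

Section Closing.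
Variable K : knotoid.
Let wf := knotoid_wf K.
Let cwf := closure_wf K.
Implicit Types (s : state K) (d : dart K) (z : dart (closure K)).

(** Contraction of the closing arc: its half at the head goes to the head, the
    other one to the leg. *)
Definition retract z : dart K :=
  match z with inl d => d | inr b => if b then khead K else kleg K end.

Definition closure_set (A : {set dart K}) : {set dart (closure K)} :=
  retract @^-1: A.

Lemma closure_set_inj : injective closure_set.
Proof.
by move=> A B /setP AB; apply/setP=> d; have := AB (inl d); rewrite !inE.
Qed.

Lemma closure_nxt_inl d : nxt d != d -> @nxt (closure K) (inl d) = inl (nxt d).
Proof. by rewrite knotoid_endpoints negb_or /= => /andP[/negPf-> /negPf->]. Qed.

Lemma smooth_closure_inl s d :
  nxt d != d -> smooth (D := closure K) s (inl d) = inl (smooth s d).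
Proof.
move=> nd; rewrite /smooth [crossing _]/=; case: crossing => [c|]; last first.
  exact: closure_nxt_inl.
rewrite [over _]/=; case: ifP => _; first exact: closure_nxt_inl.
have dE := f_finv (nxt_inj wf) d; have ndf : nxt (finv (@nxt K) d) != finv (@nxt K) d.
  by apply: contraNneq nd => fd; rewrite dE in fd; rewrite {1}fd dE.
have {1}<- : @nxt (closure K) (inl (finv (@nxt K) d)) = inl d.
  by rewrite closure_nxt_inl // dE.
exact: finv_f (nxt_inj cwf) _.
Qed.

Lemma smooth_closure_leg s : smooth (D := closure K) s (inl (kleg K)) = inr false.
Proof. by rewrite /smooth /= (end_crossing (leg_end K)) eqxx. Qed.

Lemma smooth_closure_head s : smooth (D := closure K) s (inl (khead K)) = inr true.
Proof.
by rewrite /smooth /= (end_crossing (head_end K)) eq_sym (negPf (leg_neq_head K)) eqxx.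
Qed.

Notation joined D s :=
  (connect [rel x y : dart D | (y == opp x) || (y == @smooth D s x)]).

(** This is why the closing arc does not merge two components. *)
Lemma leg_head_joined s : joined K s (kleg K) (khead K).
Proof.
have [m <- _] := travel_leg_head s; elim: m => //= m IH.
apply: connect_trans IH _.
apply: (@connect_trans _ _ (opp (iter m (travel s) (kleg K)))).
  by apply: connect1; rewrite /= eqxx.
by apply: connect1; rewrite /= eqxx orbT.
Qed.

(** In one direction, [retract] maps each step of a walk in the closure to a
    walk in K, the closing arc being replaced by k_s.  In the other, a walk in K
    is a walk in the closure, apart from the turning back at leg and head, and
    each dart is joined to its retract. *)
Lemma joined_closure s z w :
  joined (closure K) s z w
    = joined K s (retract z) (retract w).
Proof.
have sym := smooth_connect_sym wf s.
have csym := smooth_connect_sym cwf s.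
apply/idP/idP.
  move=> /connectP[q]; elim: q z => [|y q IH] z /=; first by move=> _ ->.
  case/andP=> zy /IH{IH} IH /IH; apply: connect_trans.
  case/orP: zy => /eqP ->.
    case: z => [d|[]] /=; first by apply: connect1; rewrite /= eqxx.
      by rewrite sym leg_head_joined.
    exact: leg_head_joined.
  case: z => [d|b]; last by case: b.
  have [|nd] := boolP (nxt d == d); last first.
    by rewrite smooth_closure_inl //=; apply: connect1; rewrite /= eqxx orbT.
  by rewrite knotoid_endpoints => /orP[] /eqP ->;
    rewrite ?smooth_closure_leg ?smooth_closure_head.
have retr y : joined (closure K) s y (inl (retract y)).
  case: y => [d|b]; first exact: connect0.
  by apply: connect1; rewrite /= /smooth /= eqxx.
move=> zw; apply: connect_trans (retr z) _; rewrite csym.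
apply: connect_trans (retr w) _; rewrite csym.
case/connectP: zw => q; elim: q (retract z) => [|y q IH] x /=; first by move=> _ ->.
case/andP=> xy qy /(IH _ qy); apply: connect_trans.
case/orP: xy => /eqP ->; first by apply: connect1; rewrite /= eqxx.
have [/eqP nx|nx] := boolP (nxt x == x); first by rewrite (smooth_end s nx).
by apply: connect1; rewrite /= smooth_closure_inl // eqxx orbT.
Qed.

Lemma component_closure s z :
  component (D := closure K) s z = closure_set (component s (retract z)).
Proof. by apply/setP=> w; rewrite !inE joined_closure. Qed.

Lemma component_base_point s :
  component (D := closure K) s (base_point K) = closure_set (component s (kleg K)).
Proof.
rewrite component_closure; congr closure_set; apply/setP=> d; rewrite !inE.
by rewrite (same_connect (smooth_connect_sym wf s) (leg_head_joined s)).
Qed.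

Lemma components_closure s :
  components (D := closure K) s = closure_set @: components s.
Proof.
apply/setP=> A; apply/imsetP/imsetP=> [[z _ ->]|[_ /imsetP[d _ ->] ->]].
  by exists (component s (retract z)); rewrite ?component_closure ?imset_f.
by exists (inl d); rewrite ?component_closure.
Qed.

Lemma close_is_gen (g : gen (kleg K)) :
  is_gen (base_point K) (gstate g, closure_set @: gones g).
Proof.
have /andP[sub base] := valP g; apply/andP; split => /=.
  by rewrite components_closure imsetS.
by rewrite (component_base_point (gstate g)) (mem_imset _ _ closure_set_inj).
Qed.

Definition close_gen (g : gen (kleg K)) : gen (base_point K) :=
  Sub (gstate g, closure_set @: gones g) (close_is_gen g).

Lemma open_is_gen (g : gen (base_point K)) :
  is_gen (kleg K) (gstate g, closure_set @^-1: gones g).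
Proof.
have /andP[sub base] := valP g; apply/andP; split => /=.
  apply/subsetP=> A; rewrite inE => /(subsetP sub).
  by rewrite components_closure (mem_imset _ _ closure_set_inj).
by rewrite inE -(component_base_point (gstate g)).
Qed.

Definition open_gen (g : gen (base_point K)) : gen (kleg K) :=
  Sub (gstate g, closure_set @^-1: gones g) (open_is_gen g).

Lemma close_genK : cancel close_gen open_gen.
Proof.
move=> g; apply: val_inj; rewrite [RHS]surjective_pairing; congr (_, _).
by apply/setP=> A; rewrite inE (mem_imset _ _ closure_set_inj).
Qed.

Lemma open_genK : cancel open_gen close_gen.
Proof.
move=> g; apply: val_inj; rewrite [RHS]surjective_pairing; congr (_, _).
apply/setP=> B; apply/imsetP/idP=> [[A]|gB]; first by rewrite inE => gA ->.
have /andP[/subsetP sub _] := valP g.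
have := sub B gB; rewrite components_closure => /imsetP[A _ BA].
by exists A; rewrite // inE -BA.
Qed.

(** The coefficient depends only on the cardinals of sets obtained from those of
    components by Boolean operations, and these commute with the image under
    the injective map [closure_set]. *)
Lemma close_edge_coef g g' :
  edge_coef (close_gen g) (close_gen g') = edge_coef g g'.
Proof.
have FI := closure_set_inj.
have onesE k : gones (close_gen k) = closure_set @: gones k by [].
rewrite /edge_coef !components_closure !onesE -!(imsetD_inj _ _ FI).
rewrite -!(imsetI (in2W FI)) !(card_imset _ FI).
by rewrite (inj_eq (imset_inj FI)).
Qed.

Lemma close_diff_coef g g' :
  diff_coef (close_gen g) (close_gen g') = diff_coef g g'.
Proof. by apply: eq_bigr => c _; rewrite close_edge_coef. Qed.

Lemma positive_closure c : positive (D := closure K) c = positive (D := K) c.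
Proof.
have moves d : crossing d == Some c -> @nxt (closure K) (inl d) = inl (nxt d).
  by move=> /eqP cd; rewrite closure_nxt_inl // (crossing_moves wf) ?cd.
apply/existsP/existsP=> [[[d|b] /and4P[cd od ud und]]|[d /and4P[cd od ud und]]] //.
  by exists d; apply/and4P; split=> //; move: und; rewrite moves.
by exists (inl d); apply/and4P; split=> //; rewrite moves.
Qed.

Lemma npos_closure : npos (closure K) = npos K.
Proof. by apply: eq_card => c; rewrite !inE positive_closure. Qed.

Lemma nneg_closure : nneg (closure K) = nneg K.
Proof. by apply: eq_card => c; rewrite !inE positive_closure. Qed.

Lemma close_deg g : deg (close_gen g) = deg g.
Proof.
have FI := closure_set_inj.
rewrite /deg /= components_closure -(imsetD_inj _ _ FI).
by rewrite !(card_imset _ FI).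
Qed.

Lemma close_bigrading g :
  bigrading (close_gen g) = (hgrading g, qgrading g).
Proof.
by rewrite /bigrading /qgrading /hgrading close_deg npos_closure nneg_closure.
Qed.

End Closing.

(** * Comparison of the Poincare polynomials *)

Section Comparison.
Variables (K : knotoid) (alpha : shortcut K).
Hypothesis lh : reg (kleg K) = reg (khead K).

Lemma trigrading_close g :
  trigrading alpha g = ((bigrading (close_gen g)).1, (bigrading (close_gen g)).2, 0).
Proof. by rewrite close_bigrading /trigrading ugrading_knot_type. Qed.

Lemma winding_dim_closure i j :
  winding_dim alpha i j 0 = reduced_Kh_dim (base_point K) i j.
Proof.
apply: (homology_dim_iso (@close_genK K) (@open_genK K)).
- exact: close_diff_coef.
- by move=> g /=; rewrite trigrading_close !xpair_eqE eqxx andbT.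
- by move=> g /=; rewrite trigrading_close !xpair_eqE eqxx andbT.
Qed.

Lemma perm_trigradings :
  perm_eq (undup [seq trigrading alpha g | g : gen (kleg K)])
    [seq (m, 0) | m <- undup [seq bigrading g | g : gen (base_point K)]].
Proof.
have pI : injective (fun m : int * int => (m, 0 : int)) by move=> m m' [].
apply: uniq_perm; rewrite ?(map_inj_uniq pI) ?undup_uniq // => m.
rewrite mem_undup; apply/imageP/mapP=> [[g _ ->]|[m' + ->]].
  exists (bigrading (close_gen g)); last by rewrite trigrading_close; case: bigrading.
  by rewrite mem_undup image_f.
rewrite mem_undup => /imageP[g _ ->]; exists (open_gen g) => //.
by rewrite trigrading_close open_genK; case: bigrading.
Qed.

End Comparison.

Theorem theorem3p10 (K : knotoid) (alpha : shortcut K)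
    (K_knot_type : reg (kleg K) = reg (khead K)) :
  winding_poly alpha = reduced_Kh_poly (base_point K).
Proof.
rewrite /winding_poly (perm_big _ (perm_trigradings alpha K_knot_type)) big_map.
apply: eq_bigr => m _ /=.
by rewrite expr0z mulr1 winding_dim_closure.
Qed.
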